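(* Let $k\ge 3$ be an integer and let $G_1,G_2\in\mathcal{G}_k\cup\bar{\mathcal{G}}_k$. Then the Cartesian product $G_1\square G_2$ and its complement both admit pretty good state transfer.
   Context: For a finite simple graph $G$ with adjacency matrix $A$, the transition matrix is $H(t)=\exp(-itA)$, $t\in\mathbb{R}$. For a vertex $u$, $e_u$ denotes the standard basis (column) vector indexed by $u$. The graph $G$ admits pretty good state transfer between two distinct vertices $u$ and $v$ if there exist a sequence of real numbers $\{t_m\}$ and a complex number $\gamma$ with $|\gamma|=1$ such that $\lim_{m\to\infty}H(t_m)e_u=\gamma e_v$. The graph $G$ admits pretty good state transfer if it does so between some pair of distinct vertices. The cycle $C_n$ is the graph with vertex set $\mathbb{Z}_n$ in which $a,b$ are adjacent if and only if $a-b\in\{1,n-1\}$. A proper divisor of $n$ is a positive divisor $d<n$. For a proper divisor $d$ of $n$, let $S_n(d)=\{x\in\mathbb{Z}_n:\gcd(x,n)=d\}$, and for a (possibly empty) set $D$ of proper divisors of $n$ let $S_n(D)=\bigcup_{d\in D}S_n(d)$. The gcd graph $G(n,D)$ is the graph with vertex set $\mathbb{Z}_n$ in which $a,b$ are adjacent if and only if $a-b\in S_n(D)$. The graph $C_n\cup G(n,D)$ has vertex set $\mathbb{Z}_n$ and edge set the union of the edge sets of $C_n$ and $G(n,D)$. For $k\ge 3$, $\mathcal{G}_k=\{C_{2^k}\cup G(2^k,D): D\text{ is a set of proper divisors of }2^k\text{ and }1\notin D\}$, and $\bar{\mathcal{G}}_k$ is the set of complements of the graphs in $\mathcal{G}_k$.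 The Cartesian product $G_1\square G_2$ of graphs with vertex sets $V_1,V_2$ has vertex set $V_1\times V_2$, with $(u_1,u_2)$ and $(v_1,v_2)$ adjacent if and only if either $u_1$ is adjacent to $v_1$ in $G_1$ and $u_2=v_2$, or $u_1=v_1$ and $u_2$ is adjacent to $v_2$ in $G_2$. *)

(* Defs.v *)
From HB Require Import structures.
From mathcomp Require Import all_boot all_order all_algebra.
From mathcomp Require Import boolp classical_sets reals topology normedtype sequences.
From mathcomp Require Import complex.

Set Implicit Arguments.
Unset Strict Implicit.
Unset Printing Implicit Defensive.

Import Order.TTheory GRing.Theory Num.Theory.
Import numFieldNormedType.Exports.

Local Open Scope classical_set_scope.
Local Open Scope ring_scope.
Local Open Scope complex_scope.

(* R[i] carries the topology of its modulus; matrices over R[i] then inherit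
   the entrywise topology. *)
HB.instance Definition _ (R : rcfType) := PseudoPointedMetric.copy R[i] R[i]^o.
HB.instance Definition _ (R : rcfType) := NormedModule.copy R[i] R[i]^o.

Record sgraph (V : finType) := SGraph {
  adj :> rel V;
  adj_sym : symmetric adj;
  adj_irr : irreflexive adj }.

Section GraphOperations.
Variables (V V1 V2 : finType).

Definition compl_rel (G : sgraph V) : rel V :=
  fun a b => (a != b) && ~~ G a b.

Lemma compl_rel_sym G : symmetric (compl_rel G).
Proof. by move=> a b; rewrite /compl_rel eq_sym adj_sym. Qed.

Lemma compl_rel_irr G : irreflexive (compl_rel G).
Proof. by move=> a; rewrite /compl_rel eqxx. Qed.

Definition graph_compl (G : sgraph V) : sgraph V :=
  SGraph (@compl_rel_sym G) (@compl_rel_irr G).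

Definition union_rel (G H : sgraph V) : rel V := fun a b => G a b || H a b.

Lemma union_rel_sym G H : symmetric (union_rel G H).
Proof. by move=> a b; rewrite /union_rel adj_sym [H a b]adj_sym. Qed.

Lemma union_rel_irr G H : irreflexive (union_rel G H).
Proof. by move=> a; rewrite /union_rel !adj_irr. Qed.

Definition graph_union (G H : sgraph V) : sgraph V :=
  SGraph (@union_rel_sym G H) (@union_rel_irr G H).

Definition cart_rel (G1 : sgraph V1) (G2 : sgraph V2) : rel (V1 * V2) :=
  fun u v => (G1 u.1 v.1 && (u.2 == v.2)) || ((u.1 == v.1) && G2 u.2 v.2).

Lemma cart_rel_sym G1 G2 : symmetric (cart_rel G1 G2).
Proof.
move=> u v; rewrite /cart_rel adj_sym [G2 _ _]adj_sym.
by rewrite [u.1 == _]eq_sym [u.2 == _]eq_sym.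
Qed.

Lemma cart_rel_irr G1 G2 : irreflexive (cart_rel G1 G2).
Proof. by move=> u; rewrite /cart_rel !adj_irr andbF. Qed.

Definition cart_prod (G1 : sgraph V1) (G2 : sgraph V2) : sgraph (V1 * V2)%type :=
  SGraph (@cart_rel_sym G1 G2) (@cart_rel_irr G1 G2).

End GraphOperations.

Lemma gcdn_subl (m n : nat) : (m <= n)%N -> gcdn (n - m) n = gcdn m n.
Proof.
by move=> mn; rewrite -[X in gcdn _ X](subnK mn) gcdnDl -[in RHS](subnK mn) gcdnDr gcdnC.
Qed.

Section CyclesAndGcdGraphs.
Variable n : nat.

(* 'Z_n is the ring Z/nZ for n >= 2 only.  There n - 1 is the element -1, so
   {1, n - 1} = {1, -1}. *)
Definition cycle_rel : rel 'Z_n := fun a b => a - b \in [:: 1; -1].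

Lemma cycle_rel_sym : symmetric cycle_rel.
Proof.
by move=> a b; rewrite /cycle_rel !inE -(opprB b a) eqr_opp eqr_oppLR orbC.
Qed.

Lemma cycle_rel_irr : irreflexive cycle_rel.
Proof.
by move=> a; rewrite /cycle_rel subrr !inE eq_sym oner_eq0 eq_sym oppr_eq0 oner_eq0.
Qed.

Definition cycle_graph : sgraph 'Z_n := SGraph cycle_rel_sym cycle_rel_irr.

(* d : 'I_n already gives d < n. *)
Definition proper_divisors (D : {set 'I_n}) : Prop :=
  forall d : 'I_n, d \in D -> (d %| n)%N.

Definition gcd_class (d : 'I_n) : {set 'Z_n} :=
  [set x : 'Z_n | gcdn x n == d]%SET.

Definition gcd_set (D : {set 'I_n}) : {set 'Z_n} :=
  (\bigcup_(d in D) gcd_class d)%SET.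

Definition gcd_rel (D : {set 'I_n}) : rel 'Z_n :=
  fun a b => a - b \in gcd_set D.

Lemma gcd_setN (D : {set 'I_n}) (x : 'Z_n) : x \in gcd_set D -> - x \in gcd_set D.
Proof.
case/finset.bigcupP => d dD; rewrite inE => /eqP xd.
apply/finset.bigcupP; exists d => //; rewrite inE -xd.
have [n1|n1] := ltnP 1 n; last first.
  have d0 : (d : nat) = 0%N by apply/eqP; rewrite -leqn0 -ltnS (leq_trans (ltn_ord d)).
  have := leq_ltn_trans (leq0n _) (ltn_ord d) => n0.
  by have := gcdn_gt0 x n; rewrite xd d0 n0 orbT.
have xn : (x < n)%N by exact: leq_trans (ltn_ord x) (eq_leq (Zp_cast n1)).
have -> : (- x : 'Z_n) = ((n - x) %% n)%N :> nat.
  transitivity (((Zp_trunc n).+2 - x) %% (Zp_trunc n).+2)%N; first by [].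
  by congr ((_ - _) %% _)%N; exact: Zp_cast.
by rewrite gcdn_modl gcdn_subl // ltnW.
Qed.

Lemma gcd_rel_sym D : symmetric (gcd_rel D).
Proof.
by move=> a b; apply/idP/idP => /gcd_setN; rewrite opprB.
Qed.

Lemma gcd_rel_irr D : irreflexive (gcd_rel D).
Proof.
move=> a; rewrite /gcd_rel subrr; apply/negP => /finset.bigcupP[d _].
by rewrite inE gcd0n => /eqP nd; have := ltn_ord d; rewrite -nd ltnn.
Qed.

Definition gcd_graph (D : {set 'I_n}) : sgraph 'Z_n :=
  SGraph (@gcd_rel_sym D) (@gcd_rel_irr D).

End CyclesAndGcdGraphs.

Definition calG (k : nat) (G : sgraph 'Z_(2 ^ k)) : Prop :=
  exists D : {set 'I_(2 ^ k)},
    [/\ proper_divisors D, (forall d, d \in D -> d != 1%N :> nat)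
      & G = graph_union (cycle_graph (2 ^ k)) (gcd_graph D)].

Definition calG_compl (k : nat) (G : sgraph 'Z_(2 ^ k)) : Prop :=
  exists2 H : sgraph 'Z_(2 ^ k), @calG k H & G = graph_compl H.

Arguments calG : clear implicits.
Arguments calG_compl : clear implicits.

Section StateTransfer.
Variable R : realType.

Definition expmx (m : nat) (A : 'M[R[i]]_m) : 'M[R[i]]_m :=
  lim (series (fun j : nat => (j`!%:R)^-1 *: A ^+ j) @ \oo).

Section OnGraph.
Variables (V : finType) (G : sgraph V).

Definition adjmx : 'M[R[i]]_#|V| :=
  \matrix_(a, b) (G (enum_val a) (enum_val b))%:R.

Definition transition (t : R) : 'M[R[i]]_#|V| :=
  expmx ((- 'i%C * t%:C) *: adjmx).

Definition basis_vec (u : V) : 'cV[R[i]]_#|V| := delta_mx (enum_rank u) 0.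

Definition pgst_between (u v : V) : Prop :=
  u <> v /\
  exists (t : nat -> R) (gamma : R[i]), `|gamma| = 1 /\
    (fun m => transition (t m) *m basis_vec u) @ \oo --> gamma *: basis_vec v.

Definition admits_pgst : Prop := exists u v : V, pgst_between u v.

End OnGraph.
End StateTransfer.

(* Main.v *)
Require Import Defs.
From mathcomp Require Import all_boot all_order all_algebra reals.
From mathcomp Require Import boolp classical_sets topology normedtype sequences.
From mathcomp Require Import archimedean trigo complex ring lra zify.

(* Put n = 2^k and theta_j = 2 cos (2 pi j / n).  All graphs involved are Cayley
   graphs of Z_n x Z_n, hence are diagonalized by the characters, and their
   eigenvalues are +-theta_a +- theta_b + (an integer), with signs independent of
   (a, b).  At the times t = 2 pi q, with q an integer, the integers have no
   effect, so transfer from (0, 0) to (n/2, n/2) follows once some integer q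
   makes every 2 q theta_j close to an integer of the same parity as j.

   Such a q exists because alpha = theta_1 is a root of the Eisenstein polynomial
   M obtained by iterating X^2 - 2.  Dirichlet's theorem gives a nonzero integer
   sequence s_m close to x alpha^m for small m; halving it, one may assume that
   some s_m is odd.  If the error is small, s satisfies exactly the recurrence
   given by M, so that s_m is even for m >= deg M.  Shifting s to put its last odd
   term at index 1 (backwards if needed, using M(0) = +-2), and then possibly
   adding to s its shift, makes s_1 the only odd term.  Take q = s_0 / 2: since
   theta_j = D_j(alpha) for the j-th Dickson polynomial D_j, the parity of the
   integer near 2 q theta_j is that of the linear coefficient of D_j, i.e. of j. *)

Set Implicit Arguments.
Unset Strict Implicit.
Unset Printing Implicit Defensive.

Import Order.TTheory GRing.Theory Num.Theory.
Import numFieldNormedType.Exports.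

Local Open Scope classical_set_scope.
Local Open Scope ring_scope.
Local Open Scope complex_scope.

(** * Matrix exponentials of diagonalizable matrices *)

Section MatrixTopology.
Variables (T : topologicalType) (m n : nat).

Lemma cvg_mx (I : Type) (F : set_system I) (FF : Filter F)
    (f : I -> 'M[T]_(m, n)) (L : 'M[T]_(m, n)) :
  (forall i j, (fun N => f N i j) @ F --> L i j) -> f @ F --> L.
Proof.
move=> fL A [P LP PA].
have : \forall N \near F, forall ij : 'I_m * 'I_n, P ij.1 ij.2 (f N ij.1 ij.2).
  by apply: filter_forall => -[i j]; exact: fL (LP i j).
by apply: filterS => N PN; apply: PA => i j; exact: (PN (i, j)).
Qed.

(** Uniqueness of limits is what lets the [lim] inside [expmx] be identified with a limit computed
    entry by entry. *)
Lemma hausdorff_mx : hausdorff_space T -> hausdorff_space 'M[T]_(m, n).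
Proof.
move=> hT M N MN; apply/matrixP => i j; apply: hT => A B MA NB.
(* Cylinder neighbourhoods: off the entry (i, j) the implication is vacuous, so only that entry is
   constrained. *)
have entry (L : 'M[T]_(m, n)) C : nbhs (L i j) C -> nbhs L [set M | C (M i j)].
  move=> LC; exists (fun a b => [set x | (a, b) = (i, j) -> C x]).
    move=> a b; have [[-> ->]|abij] := pselect ((a, b) = (i, j)).
      by apply: filterS LC => x Cx _.
    by apply: filterS filterT => x _ /abij.
  by move=> K /(_ i j); apply.
have [K [/= AK BK]] := MN _ _ (entry _ _ MA) (entry _ _ NB).
by exists (K i j).
Qed.

End MatrixTopology.

(** * The unit circle and the power series of [cis] *)

Section Cis.
Variable R : realType.
Implicit Types x y : R.

Definition cis x : R[i] := cos x +i* sin x.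

Lemma cisD x y : cis (x + y) = cis x * cis y.
Proof. by rewrite /cis cosD sinD; simpc; congr (_ +i* _); rewrite addrC. Qed.

Lemma normr_complex_le (a b : R) : `|a +i* b| <= (`|a| + `|b|)%:C.
Proof.
rewrite normc_def /= lecR -[leRHS]ger0_norm ?addr_ge0 // -sqrtr_sqr.
rewrite ler_sqrt ?sqr_ge0 // -(real_normK (num_real a)) -(real_normK (num_real b)).
by have := normr_ge0 a; have := normr_ge0 b; nra.
Qed.

Lemma cvg_complex (I : Type) (F : set_system I) (FF : Filter F)
    (u v : I -> R) (a b : R) :
  u @ F --> a -> v @ F --> b -> (fun k => u k +i* v k) @ F --> (a +i* b : R[i]).
Proof.
move=> ua vb; apply/cvgrPdist_lt => e e0.
have eE : e = (complex.Re e)%:C by rewrite RRe_real ?gtr0_real.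
have e0' : 0 < complex.Re e / 2 by rewrite divr_gt0 // -ltcR -eE.
move/cvgrPdist_lt/(_ _ e0') : ua => ua; move/cvgrPdist_lt/(_ _ e0') : vb => vb.
near=> k.
have uk : `|a - u k| < complex.Re e / 2 by near: k.
have vk : `|b - v k| < complex.Re e / 2 by near: k.
apply: le_lt_trans (normr_complex_le _ _) _.
by rewrite eE ltcR; lra.
Unshelve. all: by end_near. Qed.

Lemma sum_complex (I : Type) (s : seq I) (u v : I -> R) :
  \sum_(i <- s) (u i +i* v i) = (\sum_(i <- s) u i) +i* (\sum_(i <- s) v i).
Proof.
elim: s => [|i s IH]; first by rewrite !big_nil.
by rewrite !big_cons IH; simpc.
Qed.

Lemma expi_double m : ('i%C : R[i]) ^+ m.*2 = ((-1) ^+ m)%:C.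
Proof. by rewrite -mul2n exprM sqr_i rmorphXn rmorphN1. Qed.

Lemma exp_coeff_cis x j :
  (j`!%:R)^-1 * ('i%C * x%:C) ^+ j = cos_coeff x j +i* sin_coeff x j :> R[i].
Proof.
rewrite /cos_coeff /sin_coeff /= exprMn -rmorphXn.
have -> : (j`!%:R)^-1 = ((j`!%:R)^-1)%:C :> R[i] by rewrite fmorphV rmorph_nat.
have := odd_double_half j; case: (odd j); rewrite /= ?add1n ?add0n; set m := j./2 => <-.
- by rewrite exprS expi_double /= doubleK; simpc; congr (_ +i* _); ring.
- by rewrite expi_double /=; simpc; congr (_ +i* _); rewrite ?exprnP; ring.
Qed.

Lemma cvg_series_cis x :
  series (fun j => (j`!%:R)^-1 * ('i%C * x%:C) ^+ j) @ \oo --> cis x.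
Proof.
have -> : series (fun j => (j`!%:R)^-1 * ('i%C * x%:C) ^+ j) =
    (fun N => series (cos_coeff x) N +i* series (sin_coeff x) N).
  apply/funext => N; rewrite /series /= -sum_complex.
  by apply: eq_bigr => j _; rewrite exp_coeff_cis.
(* Unlocking exposes [cos] and [sin] as limits of their power series. *)
apply: cvg_complex; rewrite unlock; first exact: is_cvg_series_cos_coeff.
exact: is_cvg_series_sin_coeff.
Qed.

End Cis.

Section ExpDiagonalizable.
Variables (R : realType) (m : nat).

(** When Q is inverse to P and the columns of P are eigenvectors, this is the functional calculus: f
    is applied to the spectrum. *)
Definition conj_diag (P Q : 'M[R[i]]_m) (f : 'I_m -> R[i]) : 'M[R[i]]_m :=
  P *m diag_mx (\row_k f k) *m Q.

Lemma conj_diagE P Q f a b :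
  conj_diag P Q f a b = \sum_k P a k * f k * Q k b.
Proof.
by rewrite /conj_diag mul_mx_diag mxE; apply: eq_bigr => k _; rewrite !mxE.
Qed.

Lemma conj_diag_exp (A P Q : 'M[R[i]]_m) f j :
  P *m Q = 1%:M -> A *m P = P *m diag_mx (\row_k f k) ->
  A ^+ j = conj_diag P Q (fun k => f k ^+ j).
Proof.
move=> PQ AP; elim: j => [|j IH].
  rewrite expr0 /conj_diag; under eq_mx do rewrite expr0.
  suff -> : diag_mx (\row__ 1) = 1%:M :> 'M[R[i]]_m by rewrite mulmx1 PQ.
  by apply/matrixP => a b; rewrite !mxE.
rewrite exprS IH /conj_diag -mulmxE !mulmxA AP -(mulmxA P) mulmx_diag.
by congr (_ *m diag_mx _ *m _); apply/rowP => k; rewrite !mxE exprS.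
Qed.

Lemma cvg_conj_diag (I : Type) (F : set_system I) (FF : Filter F)
    (P Q : 'M[R[i]]_m) (f : I -> 'I_m -> R[i]) (g : 'I_m -> R[i]) :
  (forall k, f ^~ k @ F --> g k) ->
  (fun N => conj_diag P Q (f N)) @ F --> conj_diag P Q g.
Proof.
move=> fg; apply: cvg_mx => a b.
under eq_fun do rewrite conj_diagE; rewrite conj_diagE.
apply: cvg_big => [|k _]; first exact: add_continuous.
by apply: cvgM; [apply: cvgM; [exact: cvg_cst|exact: fg]|exact: cvg_cst].
Qed.

(** Each partial sum of the exponential series is [conj_diag] of scalar partial sums, so only scalar
    series have to converge; as the eigenvalues are real, their limits are values of [cis]. *)
Lemma expmx_conj_diag (A P Q : 'M[R[i]]_m) (lam : 'I_m -> R) (t : R) :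
  P *m Q = 1%:M -> A *m P = P *m diag_mx (\row_k (lam k)%:C) ->
  expmx ((- 'i%C * t%:C) *: A) = conj_diag P Q (fun k => cis (- (t * lam k))).
Proof.
move=> PQ AP; apply: cvg_lim; first exact/hausdorff_mx/norm_hausdorff.
set B := _ *: A.
have BP : B *m P = P *m diag_mx (\row_k ('i%C * (- (t * lam k))%:C)).
  rewrite -scalemxAl AP scalemxAr; congr (_ *m _); apply/matrixP => a b.
  by rewrite !mxE mulrnAr rmorphN rmorphM mulrN -!mulNr mulrA.
have -> : series (fun j => (j`!%:R)^-1 *: B ^+ j) = fun N => conj_diag P Q
    (fun k => series (fun j => (j`!%:R)^-1 * ('i%C * (- (t * lam k))%:C) ^+ j) N).
  apply/funext => N; apply/matrixP => a b; rewrite conj_diagE /series /= summxE.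
  transitivity (\sum_(0 <= j < N) \sum_k
      (j`!%:R)^-1 * (P a k * ('i%C * (- (t * lam k))%:C) ^+ j * Q k b)).
    by apply: eq_bigr => j _; rewrite mxE (conj_diag_exp _ PQ BP) conj_diagE mulr_sumr.
  rewrite exchange_big; apply: eq_bigr => k _; rewrite mulr_sumr mulr_suml.
  by apply: eq_bigr => j _; ring.
by apply: cvg_conj_diag => k; exact: cvg_series_cis.
Qed.

End ExpDiagonalizable.

(** The columns of [chi] are eigenvectors and [chi'] gives the dual basis, so e_u has coordinates
    [chi' u y]. The transition matrix multiplies them by [cis (- (t j * lam y))]; if the limiting
    factors carry them to the coordinates of e_v, transfer holds with phase 1. *)
Lemma pgst_eigenbasis (R : realType) (V : finType) (G : sgraph V) (u v : V)
    (chi chi' : V -> V -> R[i]) (lam : V -> R) (t : nat -> R) (s : V -> R[i]) :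
  u <> v ->
  (forall x y, \sum_w (G x w)%:R * chi w y = (lam y)%:C * chi x y) ->
  (forall x x', \sum_y chi x y * chi' x' y = (x == x')%:R) ->
  (forall y, (fun j => cis (- (t j * lam y))) @ \oo --> s y) ->
  (forall y, s y * chi' u y = chi' v y) ->
  pgst_between R G u v.
Proof.
move=> uv eig orth cvs sP; split=> //; exists t, 1; split; first exact: normr1.
pose P : 'M[R[i]]_#|V| := \matrix_(a, k) chi (enum_val a) (enum_val k).
pose Q : 'M[R[i]]_#|V| := \matrix_(k, b) chi' (enum_val b) (enum_val k).
have sumV (f : V -> R[i]) : \sum_(k < #|V|) f (enum_val k) = \sum_y f y.
  by rewrite [RHS](reindex (@enum_val V V)) //; exact/onW_bij/enum_val_bij.
have PQ : P *m Q = 1%:M.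
  apply/matrixP => a b; rewrite !mxE.
  under eq_bigr do rewrite !mxE.
  by rewrite (sumV (fun y => chi _ y * chi' _ y)) orth (inj_eq enum_val_inj).
have AP : adjmx R G *m P = P *m diag_mx (\row_k (lam (enum_val k))%:C).
  apply/matrixP => a k; rewrite mul_mx_diag !mxE.
  under eq_bigr do rewrite !mxE.
  by rewrite (sumV (fun w => (G _ w)%:R * chi w _)) eig mulrC.
have colE w : (\matrix_(a, b) chi' w (enum_val a)) = Q *m basis_vec R w.
  apply/matrixP => a b; rewrite !mxE (bigD1 (enum_rank w)) //= !mxE !eqxx.
  rewrite big1 ?addr0 ?enum_rankK => [|c cw]; last by rewrite !mxE (negPf cw) mulr0.
  by rewrite (ord1 b) mulr1.
have -> : 1 *: basis_vec R v = conj_diag P Q (fun k => s (enum_val k)) *m basis_vec R u.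
  rewrite scale1r /conj_diag -!mulmxA -colE.
  transitivity (P *m (Q *m basis_vec R v)); first by rewrite mulmxA PQ mul1mx.
  rewrite -colE; congr (_ *m _); apply/matrixP => a b.
  by rewrite mul_diag_mx !mxE sP.
apply: cvg_mx => a b.
have ev (M : 'M[R[i]]_#|V|) : (M *m basis_vec R u) a b = M a (enum_rank u).
  rewrite !mxE (bigD1 (enum_rank u)) //= !mxE !eqxx (ord1 b) mulr1.
  by rewrite big1 ?addr0 // => c cu; rewrite !mxE (negPf cu) mulr0.
under eq_fun do rewrite ev /transition (expmx_conj_diag _ PQ AP) conj_diagE.
rewrite ev conj_diagE; apply: cvg_big => [|k _]; first exact: add_continuous.
by apply: cvgM; [apply: cvgM; [exact: cvg_cst|exact: cvs]|exact: cvg_cst].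
Qed.

(** * Simultaneous approximation by Eisenstein sequences *)

Section SimultaneousApproximation.
Variable R : realType.

(** Pigeonhole: among (K+1)^W + 1 multiples of [beta], two have fractional parts in the same box of
    side 1/(K+1), and q is the difference of the two multipliers. *)
Lemma dirichlet_approximation (W : nat) (beta : nat -> R) (e : R) : 0 < e ->
  exists (q : nat) (s : nat -> int), (0 < q)%N /\
    forall m, (m < W)%N -> `|(s m)%:~R - q%:R * beta m| < e.
Proof.
move=> e0; have [K Ke] : exists K : nat, K.+1%:R^-1 < e.
  exists (Num.bound e^-1); rewrite invf_plt ?posrE //.
  apply: lt_trans (archi_boundP _) _; first by rewrite invr_ge0 ltW.
  by rewrite ltr_nat.
pose fr (q m : nat) : R := q%:R * beta m - (Num.floor (q%:R * beta m))%:~R.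
pose dig q m := Num.floor (K.+1%:R * fr q m).
have fr01 q m : 0 <= fr q m < 1.
  rewrite /fr; have := floor_itv (q%:R * beta m); rewrite intrD => /andP[].
  lra.
have dig0 q m : 0 <= dig q m.
  by rewrite /dig floor_ge0 mulr_ge0 //; case/andP: (fr01 q m).
have digK q m : (absz (dig q m) < K.+1)%N.
  rewrite -ltz_nat gez0_abs // -(ltr_int R); apply: le_lt_trans (ge_floor _) _.
  rewrite -[X in _ < X]mulr1 ltr_pM2l //; by case/andP: (fr01 q m).
pose f (q : 'I_(K.+1 ^ W).+1) := [ffun m : 'I_W => Ordinal (digK q m)].
have : ~~ injectiveb f.
  apply/negP => /injectiveP/leq_card.
  by rewrite card_ffun !card_ord ltnn.
case/injectivePn => q1 [q2 q12 /ffunP fq].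
wlog lt12 : q1 q2 q12 fq / (q1 < q2)%N => [H|].
  case: (ltngtP q1 q2) => [lt|lt|/val_inj/eqP]; last by rewrite (negPf q12).
    exact: H lt.
  by apply: H lt => [|m]; rewrite 1?eq_sym // fq.
exists (q2 - q1)%N, (fun m => Num.floor (q2%:R * beta m) - Num.floor (q1%:R * beta m)).
split=> [|m mW]; first by rewrite subn_gt0.
have : dig q1 m = dig q2 m.
  have := fq (Ordinal mW); rewrite !ffunE => -[] /eqP.
  by rewrite -eqz_nat !gez0_abs // => /eqP.
have := floor_itv (K.+1%:R * fr q1 m); have := floor_itv (K.+1%:R * fr q2 m).
rewrite -/(dig q1 m) -/(dig q2 m) => i2 i1 dE; rewrite dE in i1.
rewrite intrD in i1 i2; set D := (dig q2 m)%:~R in i1 i2.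
apply: lt_trans Ke; rewrite -[X in _ < X]mul1r ltr_pdivlMr //.
have -> : (Num.floor (q2%:R * beta m) - Num.floor (q1%:R * beta m))%:~R -
    (q2 - q1)%:R * beta m = fr q1 m - fr q2 m.
  by rewrite natrB ?(ltnW lt12) // rmorphB /= /fr; ring.
rewrite -[K.+1%:R]ger0_norm // -normrM ltr_norml.
by case/andP: i1 => ? ?; case/andP: i2 => ? ?; apply/andP; split; lra.
Qed.

Definition approximates (alpha e : R) (W : nat) (x : R) (s : nat -> int) :=
  forall m, (m < W)%N -> `|(s m)%:~R - x * alpha ^+ m| < e.

(** Descent on |s_0|: while all terms in the window are even, halving both s and x keeps the
    approximation and makes the nonzero s_0 smaller. *)
Lemma primitive_approximation (alpha e : R) (W : nat) : 0 < e -> (0 < W)%N ->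
  exists x s, approximates alpha e W x s /\
    exists2 m, (m < W)%N & ~~ (2 %| s m)%Z.
Proof.
move=> e0 W0.
suff H n x s : (absz (s 0%N) < n)%N -> s 0%N != 0 -> approximates alpha e W x s ->
    exists x s, approximates alpha e W x s /\
      exists2 m, (m < W)%N & ~~ (2 %| s m)%Z.
  (* An error below 1 excludes s_0 = 0, since s_0 approximates q >= 1. *)
  have e1 : 0 < Num.min e 1 by rewrite lt_min e0 ltr01.
  have [q [s [q0 qs]]] := dirichlet_approximation W (fun m => alpha ^+ m) e1.
  apply: (H (absz (s 0%N)).+1 q%:R s) => // [|m mW]; last first.
    by apply: lt_le_trans (qs m mW) _; rewrite ge_min lexx.
  apply: contraTneq (qs _ W0) => s0; rewrite s0 expr0 mulr1 sub0r normrN.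
  by rewrite -leNgt ge_min normr_nat ler1n q0 orbT.
elim: n x s => [//|n IH] x s sn s0 xs.
have [even|] := boolP [forall m : 'I_W, (2 %| s m)%Z]; last first.
  case/forallPn => m odd; exists x, s; split=> //; exists m => //.
have {}even m : (m < W)%N -> s m = (s m %/ 2)%Z * 2.
  by move=> mW; rewrite divzK //; exact: (forallP even (Ordinal mW)).
apply: (IH (x / 2) (fun m => (s m %/ 2)%Z)).
- by have := even _ W0; move: sn s0; lia.
- by apply: contraNneq s0 => s0; rewrite even // s0 mul0r.
move=> m mW; have := xs m mW; rewrite {1}even // intrM !ltr_norml => /andP[? ?].
by apply/andP; split; lra.
Qed.

(** * Integer sequences close to x alpha^m, for alpha a root of an Eisenstein polynomial at 2 *)

Section EisensteinApproximation.
Variables (alpha : R) (d : nat) (c : nat -> int) (u : int).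
Hypotheses (d_gt1 : (1 < d)%N) (c_lead : c d = 1) (c_const : c 0%N = 2 * u).
Hypothesis u_unit : u * u = 1.
Hypothesis c_even : forall i, (i < d)%N -> (2 %| c i)%Z.
Hypothesis c_root : \sum_(i < d.+1) (c i)%:~R * alpha ^+ i = 0.

Let B : R := \sum_(i < d.+1) `|(c i)%:~R|.

(** The sequence x alpha^m satisfies the recurrence exactly, so only the approximation errors,
    weighted by the coefficients, survive. *)
Lemma approx_combination_le e W x s k :
  approximates alpha e W x s -> (k + d < W)%N ->
  `|(\sum_(i < d.+1) c i * s (k + i)%N)%:~R| <= B * e.
Proof.
move=> xs kW.
have -> : (\sum_(i < d.+1) c i * s (k + i)%N)%:~R = \sum_(i < d.+1)
    (c i)%:~R * ((s (k + i)%N)%:~R - x * alpha ^+ (k + i)) :> R.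
  rewrite rmorph_sum /=; apply/esym.
  transitivity (\sum_(i < d.+1) ((c i * s (k + i)%N)%:~R -
    x * alpha ^+ k * ((c i)%:~R * alpha ^+ i)) : R).
    by apply: eq_bigr => i _; rewrite intrM exprD; ring.
  by rewrite sumrB -mulr_sumr c_root mulr0 subr0.
apply: le_trans (ler_norm_sum _ _ _) _; rewrite mulr_suml; apply: ler_sum => i _.
rewrite normrM ler_wpM2l // ltW // xs //.
by apply: leq_ltn_trans kW; rewrite leq_add2l -ltnS.
Qed.

(* The recurrence holds exactly, an integer of absolute value < 1 being 0. *)
Lemma approx_even e W x s k : B * e < 1 ->
  approximates alpha e W x s -> (k + d < W)%N -> (2 %| s (k + d)%N)%Z.
Proof.
move=> Be xs kW; have := le_lt_trans (approx_combination_le xs kW) Be.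
rewrite -intr_norm ltrz1 big_ord_recr /= c_lead mul1r.
set S := \sum_(i < d) _ => lt1.
have -> : s (k + d)%N = - S by move: lt1; lia.
rewrite rpredN; apply: rpred_sum => i _.
by rewrite dvdz_mulr ?c_even.
Qed.

Let B_ge1 : 1 <= B.
Proof.
rewrite /B big_ord_recr /= c_lead normr1 lerDr; exact: sumr_ge0.
Qed.

Let alpha_neq0 : alpha != 0.
Proof.
apply: contra_eq_neq c_root => ->.
rewrite big_ord_recl big1 => [|i _]; last by rewrite expr0n mulr0.
rewrite expr0 mulr1 addr0 intr_eq0 c_const.
by move: u_unit; lia.
Qed.

Lemma approx_parity1 W e : 0 < e -> exists x t,
  [/\ approximates alpha e W x t, ~~ (2 %| t 1%N)%Z
    & forall m, (1 < m < W)%N -> (2 %| t m)%Z].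
Proof.
move=> e0; have B0 : 0 < B by apply: lt_le_trans B_ge1.
(* B e1 < 1 makes the recurrence exact; B e1 <= e controls the error of a backward shift. *)
pose e1 := Num.min e (1 / 2) / B.
have Be1 : B * e1 = Num.min e (1 / 2) by rewrite mulrC divfK ?gt_eqF.
have e1_gt0 : 0 < e1 by rewrite divr_gt0 // lt_min e0; lra.
have Be : B * e1 <= e by rewrite Be1 ge_min lexx.
have Be_lt1 : B * e1 < 1 by rewrite Be1 gt_min; apply/orP; right; lra.
have e1e : e1 <= e by apply: le_trans Be; rewrite ler_peMl // ltW.
(* The extra d + 1 terms leave room for the recurrence and for a forward shift, as the last odd
   index is below d. *)
have W0 : (0 < W + d.+1)%N by rewrite addnS.
have [x [s [xs [m1 m1W odd1]]]] := primitive_approximation alpha e1_gt0 W0.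
have sd m : (d <= m < W + d.+1)%N -> (2 %| s m)%Z.
  move=> /andP[dm mW]; rewrite -(subnK dm).
  by apply: approx_even Be_lt1 xs _; rewrite subnK.
pose odds := [pred m | (m < W + d.+1)%N && ~~ (2 %| s m)%Z].
have exodd : exists m, odds m by exists m1; rewrite /= m1W.
have ubodd m : odds m -> (m <= W + d.+1)%N by case/andP => /ltnW.
case: (ex_maxnP exodd ubodd) => m0 /andP[m0W odd0] max0.
have m0d : (m0 < d)%N.
  by rewrite ltnNge; apply: contra odd0 => dm; apply: sd; rewrite dm.
have even m : (m0 < m < W + d.+1)%N -> (2 %| s m)%Z.
  move=> /andP[m0m mW]; apply: contraLR m0m => om; rewrite -leqNgt.
  by apply: max0; rewrite /= mW.
case: m0 => [|m0] in m0W odd0 max0 m0d even.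
  (* Only s_0 is odd, so s must be extended to index -1. The sum is even: its coefficients are even
     except the leading one, which multiplies the even s_(d-1), as d > 1. Hence 2 u s_(-1) + 2 h = 0
     has the integer solution s_(-1) = - u h. *)
  have /dvdzP[h hE] : (2 %| \sum_(i < d) c i.+1 * s i)%Z.
    apply: rpred_sum => i _; have [id|] := ltnP i.+1 d.
      by rewrite dvdz_mulr ?c_even.
    move=> di; rewrite dvdz_mull //; apply: even.
    by move: di d_gt1 (ltn_ord i) m0W; clear; lia.
  exists (x / alpha), (fun m => if m is m'.+1 then s m' else - u * h).
  split=> [m mW||[|[|m]]] //; last by move=> mW; apply: even; move: mW; clear; lia.
  case: m mW => [_|m mW]; last first.
    rewrite exprS mulrA divfK //; apply: lt_le_trans e1e; apply: xs.
    by move: mW; clear; lia.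
  (* Twice the error at the new term is a combination of the old errors, hence at most B e1 <= e;
     dividing by 2 gives the strict bound. *)
  have : `|(2 * (- u * h))%:~R - 2 * (x / alpha)| <= e.
    apply: le_trans Be.
    have -> : (2 * (- u * h))%:~R = - u%:~R * (\sum_(i < d) c i.+1 * s i)%:~R :> R.
      by rewrite hE; rewrite !intrM ?rmorphN; ring.
    have -> : 2 * (x / alpha) =
        - u%:~R * (\sum_(i < d) (c i.+1)%:~R * (x * alpha ^+ i)).
      have uu : (u%:~R * u%:~R : R) = 1 by rewrite -intrM u_unit.
      have := c_root; rewrite big_ord_recl /= expr0 mulr1 c_const => /eqP.
      rewrite addr_eq0 => /eqP root.
      apply: (mulIf alpha_neq0); rewrite -mulrA divfK //.
      transitivity (u%:~R * x * (2 * u)%:~R).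
        by rewrite intrM -[LHS]mul1r -{1}uu; ring.
      rewrite root mulrN mulNr mulNr mulr_sumr mulr_sumr mulr_suml; congr (- _).
      by apply: eq_bigr => i _; rewrite /bump leq0n add1n exprS; ring.
    rewrite -mulrBr normrM normrN.
    have -> : `|u%:~R| = 1 :> R.
      by rewrite -intr_norm (_ : `|u| = 1) //; move: u_unit; clear; nia.
    rewrite mul1r rmorph_sum /= -sumrB; apply: le_trans (ler_norm_sum _ _ _) _.
    rewrite /B big_ord_recl mulrDl mulr_suml -[leLHS]add0r.
    apply: lerD; first by rewrite mulr_ge0 // ltW.
    apply: ler_sum => i _; rewrite intrM -mulrBr normrM ler_wpM2l // ltW // xs //.
    by have := ltn_ord i; clear; lia.
  by rewrite expr0 mulr1 intrM -mulrBr normrM ger0_norm //; lra.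
exists (x * alpha ^+ m0), (fun m => s (m0 + m)%N).
split=> [m mW||m mW]; last by apply: even; move: mW m0d; clear; lia.
  rewrite -mulrA -exprD; apply: lt_le_trans e1e; apply: xs.
  by move: mW m0d; clear; lia.
by rewrite addn1.
Qed.

Lemma approx_parity W e : 0 < e -> exists x t,
  [/\ approximates alpha e W x t, (2 %| t 0%N)%Z, ~~ (2 %| t 1%N)%Z
    & forall m, (1 < m < W)%N -> (2 %| t m)%Z].
Proof.
move=> e0; have e2 : 0 < e / 2 by lra.
have [x [t [xt t1 t2]]] := approx_parity1 W.+3 e2.
have [t0|t0] := boolP (2 %| t 0%N)%Z.
  exists x, t; split=> // m mW; last by apply: t2; move: mW; clear; lia.
  by apply: lt_trans (xt m _) _; [move: mW; clear; lia|lra].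
(* Adding the shift turns the parities odd, odd, even, ... into even, odd, even, ... *)
exists (x + x * alpha), (fun m => t m + t m.+1); split=> [m mW|||m mW].
- have -> : (t m + t m.+1)%:~R - (x + x * alpha) * alpha ^+ m =
      ((t m)%:~R - x * alpha ^+ m) + ((t m.+1)%:~R - x * alpha ^+ m.+1).
    by rewrite intrD exprS; ring.
  apply: le_lt_trans (ler_normD _ _) _.
  have m1 : (m.+1 < W.+3)%N by move: mW; clear; lia.
  by have := xt m (ltnW m1); have := xt m.+1 m1; lra.
- by move: t0 t1; clear; lia.
- by have := t2 2%N isT; move: t1; clear; lia.
- by apply: rpredD; apply: t2; move: mW; clear; lia.
Qed.

(** With q = t_0 / 2, each t_0 alpha^m is close to t_m because t_0 is close to x. So 2 q P(alpha) is
    close to the sum of P_m t_m, in which only P_1 t_1 can be odd. *)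
Lemma integer_poly_approx (P : nat -> {poly int}) n e : 0 < e ->
  exists q : int, forall j, (j < n)%N -> exists z : int,
    `|2 * q%:~R * (map_poly intr (P j)).[alpha] - z%:~R| < e /\
    (2 %| z - (P j)`_1)%Z.
Proof.
(* The added 2 guarantees that indices 0 and 1 lie in the window even if every polynomial is
   constant. *)
move=> e0; pose W := (\max_(j < n) size (P j)).+2.
pose wt m : R := 1 + `|alpha| ^+ m.
pose S : R := \sum_(j < n) \sum_(m < W) `|((P j)`_m)%:~R| * wt m.
have wt0 m : 0 <= wt m by rewrite addr_ge0 ?exprn_ge0.
have S0 : 0 <= S by apply: sumr_ge0 => j _; apply: sumr_ge0 => m _; exact: mulr_ge0.
have e1 : 0 < e / (1 + S) by rewrite divr_gt0 // ltr_pwDl.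
have [x [t [xt t0 t1 t2]]] := approx_parity W e1.
exists (t 0%N %/ 2)%Z => j jn; exists (\sum_(m < W) (P j)`_m * t m); split; last first.
  rewrite !big_ord_recl /=.
  set Z := \sum_(i < _) _.
  have /dvdzP[z ->] : (2 %| Z)%Z.
    by apply: rpred_sum => i _; rewrite dvdz_mull // t2 //= /bump /= !add1n !ltnS.
  have [b ->] : exists b, t 1%N = b * 2 + 1.
    by exists (t 1%N %/ 2)%Z; move: t1; clear; lia.
  have /dvdzP[a ->] := t0; rewrite -[bump 0 0]/1%N.
  by apply/dvdzP; exists ((P j)`_0 * a + (P j)`_1 * b + z); ring.
have PW : (size (P j) <= W)%N.
  by rewrite /W !leqW //; exact: (leq_bigmax (Ordinal jn)).
have -> : 2 * (t 0%N %/ 2)%Z%:~R = (t 0%N)%:~R :> R.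
  by rewrite -[in RHS](divzK t0) intrM mulrC.
rewrite (@horner_coef_wide _ W) ?(leq_trans (size_poly _ _)) //.
rewrite rmorph_sum /= mulr_sumr -sumrB.
apply: le_lt_trans (ler_norm_sum _ _ _) _.
apply: (@le_lt_trans _ _ (e / (1 + S) * S)); last first.
  by rewrite mulrAC ltr_pdivrMr ?ltr_pM2l ?ltr_pwDl // ltrDr.
rewrite {2}/S (bigD1 (Ordinal jn)) //= mulrDr ler_wpDr //.
  rewrite mulr_ge0 ?(ltW e1) //.
  by apply: sumr_ge0 => i _; apply: sumr_ge0 => m _; exact: mulr_ge0.
rewrite mulr_sumr; apply: ler_sum => m _; rewrite coef_map /= intrM.
rewrite mulrCA -mulrBr normrM mulrCA ler_wpM2l //.
have := xt m (ltn_ord m); have := xt 0%N (ltn0Sn _); rewrite expr0 mulr1 => h0 hm.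
have -> : (t 0%N)%:~R * alpha ^+ m - (t m)%:~R =
    ((t 0%N)%:~R - x) * alpha ^+ m - ((t m)%:~R - x * alpha ^+ m) by ring.
rewrite /wt mulrDr mulr1 [leRHS]addrC; apply: le_trans (ler_normB _ _) _.
by rewrite lerD // ?normrM ?normrX ?ler_wpM2r ?exprn_ge0 // ltW.
Qed.

End EisensteinApproximation.
End SimultaneousApproximation.

(* Dickson polynomials, characterized by D_j(2 cos x) = 2 cos (j x). *)
Fixpoint dickson (j : nat) : {poly int} :=
  match j with
  | 0 => 2%:P
  | 1 => 'X
  | (i.+1 as i1).+1 => 'X * dickson i1 - dickson i
  end.

Lemma dickson_cos (R : realType) (x : R) j :
  (map_poly intr (dickson j)).[2 * cos x] = 2 * cos (x *+ j).
Proof.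
suff : (map_poly intr (dickson j)).[2 * cos x] = 2 * cos (x *+ j) /\
    (map_poly intr (dickson j.+1)).[2 * cos x] = 2 * cos (x *+ j.+1) by case.
elim: j => [|j [IH0 IH1]].
  by rewrite /= map_polyC hornerC mulr0n cos0 mulr1 map_polyX hornerX.
split=> //; rewrite -[dickson j.+2]/('X * dickson j.+1 - dickson j).
rewrite rmorphB rmorphM /= map_polyX hornerD hornerN hornerM hornerX IH0 IH1.
have -> : x *+ j = x *+ j.+1 - x by rewrite mulrS addrAC subrr add0r.
rewrite [in RHS]mulrS cosB cosD; ring.
Qed.

(** Modulo 2 the constant coefficients stay zero, so the recurrence gives D_(j+2) the same linear
    coefficient as D_j. *)
Lemma dickson_coef01 j :
  (2 %| (dickson j)`_0)%Z /\ (2 %| (dickson j)`_1 - j%:Z)%Z.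
Proof.
suff : [/\ (2 %| (dickson j)`_0)%Z, (2 %| (dickson j)`_1 - j%:Z)%Z,
    (2 %| (dickson j.+1)`_0)%Z & (2 %| (dickson j.+1)`_1 - j.+1%:Z)%Z] by case.
elim: j => [|j [a0 a1 b0 b1]]; first by rewrite /= !coefC !coefX.
split=> //; rewrite -[dickson j.+2]/('X * dickson j.+1 - dickson j);
  move: (dickson j.+1) (dickson j) a0 a1 b0 b1 => p q a0 a1 b0 b1.
  by rewrite coefB coefXM /= sub0r rpredN.
rewrite coefB coefXM /=; move: a0 a1 b0 b1; clear.
by move: p`_0 p`_1 q`_0 q`_1 => A B C D; lia.
Qed.

(* The polynomial X^(2^r) + 2 N is the r-th iterate of X^2 - 2. *)
Lemma cos_pow2_eisenstein (r : nat) : (0 < r)%N -> exists N : {poly int},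
  [/\ (size N <= 2 ^ r)%N, N`_0 * N`_0 = 1
    & forall (R : realType) (x : R), 2 * cos (x *+ 2 ^ r) =
        (2 * cos x) ^+ (2 ^ r) + 2 * (map_poly intr N).[2 * cos x]].
Proof.
have cos2 (R : realType) (x : R) : 2 * cos (x *+ 2) = (2 * cos x) ^+ 2 - 2.
  by rewrite cos_mulr2n; ring.
case: r => // r _; elim: r => [|r [N [sN N0 cosN]]].
  exists (- 1)%:P; split; first by rewrite (leq_trans (size_polyC_leq1 _)).
    by rewrite coefC.
  move=> R x; rewrite cos2 map_polyC hornerC /= rmorphN1; ring.
set d := (2 ^ r.+1)%N in sN cosN *.
have d0 : (0 < d)%N by rewrite expn_gt0.
have -> : (2 ^ r.+2 = d + d)%N by rewrite expnS mul2n addnn.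
exists (2%:P * ('X^d * N) + 2%:P * (N * N) - 1); split.
- apply: (leq_trans (size_polyD _ _)); rewrite size_polyN size_poly1 geq_max.
  rewrite (leq_trans d0) ?leq_addr // andbT.
  apply: (leq_trans (size_polyD _ _)); rewrite geq_max !mul_polyC.
  rewrite !(leq_trans (size_scale_leq _ _)) //.
    rewrite (leq_trans (size_polyMleq _ _)) //; move: sN; clear; lia.
  rewrite (leq_trans (size_polyMleq _ _)) // size_polyXn.
  move: sN; clear; lia.
- rewrite coefB coefD !mul_polyC !coefZ coefXnM d0 coef1 coefM big_ord1.
  by rewrite subnn N0.
move=> R x; rewrite mulrnDr -mulr2n cos2 cosN exprD.
rewrite rmorphB rmorphD !rmorphM /= !map_polyC map_polyXn rmorph1.
rewrite !(hornerD, hornerN, hornerM, hornerXn, hornerC) /=; ring.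
Qed.

(** * Spectra of the graphs *)

Definition has_spectrum (C : comNzRingType) (V : finType) (chi : V -> V -> C)
    (G : sgraph V) (lam : V -> C) :=
  forall x y, \sum_w (G x w)%:R * chi w y = lam y * chi x y.

(** The complement has adjacency matrix J - I - A, and the all-ones matrix J kills every column
    except the constant one, indexed by [o]. *)
Lemma spectrum_compl (C : comNzRingType) (V : finType) (chi : V -> V -> C) (o : V)
    (G : sgraph V) (lam : V -> C) :
  (forall x, chi x o = 1) ->
  (forall y, \sum_w chi w y = (#|V| * (y == o))%:R) ->
  has_spectrum chi G lam ->
  has_spectrum chi (graph_compl G) (fun y => (#|V| * (y == o))%:R - 1 - lam y).
Proof.
move=> chio orth spec x y.
have -> : \sum_w (graph_compl G x w)%:R * chi w y =
    \sum_w chi w y - \sum_w (x == w)%:R * chi w y - \sum_w (G x w)%:R * chi w y.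
  rewrite -!sumrB; apply: eq_bigr => w _; rewrite /= /compl_rel.
  have [<-|_] := eqVneq x w; first by rewrite adj_irr; rewrite /=; ring.
  by case: (G x w); rewrite /=; ring.
rewrite orth spec !mulrBl mul1r (bigD1 x) //= eqxx mul1r big1 ?addr0 => [|w wx].
  by have [->|_] := eqVneq y o; rewrite ?muln0 ?mul0r // !chio !mulr1.
by rewrite eq_sym (negPf wx) mul0r.
Qed.

Lemma spectrum_cart (C : comNzRingType) (V1 V2 : finType)
    (chi1 : V1 -> V1 -> C) (chi2 : V2 -> V2 -> C)
    (G1 : sgraph V1) (G2 : sgraph V2) (lam1 : V1 -> C) (lam2 : V2 -> C) :
  has_spectrum chi1 G1 lam1 -> has_spectrum chi2 G2 lam2 ->
  has_spectrum (fun w y : V1 * V2 => chi1 w.1 y.1 * chi2 w.2 y.2)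
    (cart_prod G1 G2) (fun y => lam1 y.1 + lam2 y.2).
Proof.
move=> s1 s2 [x1 x2] [y1 y2] /=.
rewrite -(pair_bigA _ (fun w1 w2 => (cart_prod G1 G2 (x1, x2) (w1, w2))%:R *
  (chi1 w1 y1 * chi2 w2 y2))) /=.
transitivity (\sum_w1 \sum_w2
  (((G1 x1 w1)%:R * chi1 w1 y1) * ((x2 == w2)%:R * chi2 w2 y2) +
   ((x1 == w1)%:R * chi1 w1 y1) * ((G2 x2 w2)%:R * chi2 w2 y2))).
  apply: eq_bigr => w1 _; apply: eq_bigr => w2 _; rewrite /cart_rel /=.
  (* The disjunction may be replaced by a sum: both alternatives could hold only on the diagonal,
     where irreflexivity makes both vanish. *)
  have [<-|_] := eqVneq x1 w1; have [<-|_] := eqVneq x2 w2;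
    by rewrite ?adj_irr ?andbF ?andbT ?orbF /=; ring.
have delta (V : finType) (f : V -> C) x : \sum_w (x == w)%:R * f w = f x.
  rewrite (bigD1 x) //= eqxx mul1r big1 ?addr0 // => w wx.
  by rewrite eq_sym (negPf wx) mul0r.
under eq_bigr do rewrite big_split -!mulr_sumr delta s2.
by rewrite big_split -!mulr_suml delta s1 /=; ring.
Qed.

(** * Characters of Z_n for n = 2^k and integrality of gcd-class sums *)

Section Characters.
Variables (C : fieldType) (k : nat) (w : C).
Let n := (2 ^ k)%N.
Hypotheses (k_gt1 : (1 < k)%N) (w_prim : n.-primitive_root w).

(** The exponent is the product of natural representatives; additivity modulo n comes from w^n =
    1. *)
Definition chi (x y : 'Z_n) : C := w ^+ (x * y).

Let n_gt1 : (1 < n)%N. Proof. exact: ltn_trans k_gt1 (ltn_expl k (isT : 1 < 2)%N). Qed.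

Let w_unit m : w ^+ m != 0.
Proof.
rewrite expf_neq0 //; apply: contra_eq_neq (prim_expr_order w_prim) => ->.
by rewrite expr0n eqn0Ngt (ltnW n_gt1) eq_sym oner_eq0.
Qed.

Lemma val_ZpD (x y : 'Z_n) : (x + y : 'Z_n) = ((x + y) %% n)%N :> nat.
Proof. by rewrite /=; congr (_ %% _)%N; exact: Zp_cast. Qed.

Lemma chiC x y : chi x y = chi y x. Proof. by rewrite /chi mulnC. Qed.

Lemma chiD x x' y : chi (x + x') y = chi x y * chi x' y.
Proof.
rewrite /chi -exprD -mulnDl -(prim_expr_mod w_prim) -[RHS](prim_expr_mod w_prim).
by rewrite val_ZpD modnMml.
Qed.

Lemma chi0 y : chi 0 y = 1. Proof. by rewrite /chi mul0n expr0. Qed.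

Lemma chi_neq0 x y : chi x y != 0. Proof. exact: w_unit. Qed.

Lemma chiN x y : chi (- x) y = (chi x y)^-1.
Proof.
by apply: (mulIf (chi_neq0 x y)); rewrite -chiD addNr chi0 mulVf ?chi_neq0.
Qed.

Lemma chi1_eq1 y : (chi 1 y == 1) = (y == 0).
Proof.
rewrite /chi (_ : (1 : 'Z_n) = 1%N :> nat) // mul1n -(prim_order_dvd w_prim).
apply/idP/eqP => [|->] //.
have yn : (y < n)%N by rewrite -[X in (_ < X)%N](Zp_cast n_gt1) ltn_ord.
move=> ny; apply/val_inj/eqP; rewrite -leqn0 leqNgt.
by apply/negP => /dvdn_leq/(_ ny); rewrite leqNgt yn.
Qed.

(** Either the character is trivial on H and the sum is |H|, or translation by some h in H
    multiplies the sum by [chi h y], different from 1, so it vanishes. *)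
Lemma sum_chi_closed (H : {set 'Z_n}) y :
  (forall h x, h \in H -> (x + h \in H) = (x \in H)) ->
  exists m : nat, \sum_(x in H) chi x y = m%:R.
Proof.
move=> HD; have [/forallP triv|] := boolP [forall h, (h \in H) ==> (chi h y == 1)].
  exists #|H|; rewrite -sum1_card natr_sum; apply: eq_bigr => x xH.
  exact/eqP/(implyP (triv x)).
case/forallPn => h; rewrite negb_imply => /andP[hH h1]; exists 0%N; apply/eqP.
have : (1 - chi h y) * \sum_(x in H) chi x y == 0.
  rewrite mulrBl mul1r subr_eq0; apply/eqP; rewrite mulr_sumr.
  rewrite [LHS](reindex_inj (addIr h)); apply: eq_big => x; first exact: HD.
  by rewrite chiD mulrC.
by rewrite mulf_eq0 subr_eq0 eq_sym (negPf h1).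
Qed.

Lemma sum_chi y : \sum_x chi x y = (#|{: 'Z_n}| * (y == 0))%:R.
Proof.
have [->|y0] := eqVneq y 0.
  rewrite muln1 -sum1_card natr_sum; apply: eq_bigr => x _.
  by rewrite chiC chi0.
rewrite muln0; apply/eqP.
have : (1 - chi 1 y) * \sum_x chi x y == 0.
  rewrite mulrBl mul1r subr_eq0; apply/eqP; rewrite mulr_sumr.
  by rewrite [LHS](reindex_inj (addIr 1)); apply: eq_bigr => x _; rewrite chiD mulrC.
by rewrite mulf_eq0 subr_eq0 eq_sym chi1_eq1 (negPf y0).
Qed.

Lemma gcdn_pow2 x i : (i < k)%N ->
  (gcdn x n == 2 ^ i)%N = (2 ^ i %| x)%N && ~~ (2 ^ i.+1 %| x)%N.
Proof.
move=> ik; have /(dvdn_pfactor _ _ (isT : prime 2))[j jk gE] := dvdn_gcdr x n.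
have dg m : (m <= k)%N -> (2 ^ m %| x)%N = (m <= j)%N.
  by move=> mk; rewrite -(@dvdn_Pexp2l 2 m j) // -gE dvdn_gcd dvdn_exp2l // andbT.
rewrite !dg ?(ltnW ik) // gE eqn_exp2l // eqn_leq -ltnNge ltnS; apply: andbC.
Qed.

(** For d = 2^i the class is the subgroup of multiples of 2^i minus that of multiples of 2^(i+1),
    and both sums are integers. *)
Lemma sum_chi_gcd_class (d : 'I_n) y : (d %| n)%N ->
  exists m : int, \sum_(x in gcd_class d) chi x y = m%:~R.
Proof.
move=> /(dvdn_pfactor _ _ (isT : prime 2))[i _ dE].
have ik : (i < k)%N by rewrite -(@ltn_exp2l 2) // -dE.
pose H j := [set x : 'Z_n | (2 ^ j %| x)%N]%SET.
have HD j : (j <= k)%N -> forall h x, h \in H j -> (x + h \in H j) = (x \in H j).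
  move=> jk h x; rewrite !inE val_ZpD => hH.
  by rewrite /dvdn modn_dvdm ?dvdn_exp2l // -/(dvdn _ _) dvdn_addl.
have [m1 H1] := sum_chi_closed y (HD _ (ltnW ik)).
have [m2 H2] := sum_chi_closed y (HD _ ik).
exists (m1%:Z - m2%:Z); rewrite rmorphB /= -!pmulrn -H1 -H2.
apply/esym; rewrite (big_setID (H i.+1)) /= addrC.
have -> : (H i :&: H i.+1 = H i.+1)%SET.
  by apply/setP => x; rewrite !inE andb_idl //; apply: dvdn_trans; exact: dvdn_exp2l.
by rewrite addrK; apply: eq_bigl => x; rewrite !inE dE gcdn_pow2 // andbC.
Qed.

Lemma sum_chi_gcd_set (D : {set 'I_n}) y : proper_divisors D ->
  exists m : int, \sum_(x in gcd_set D) chi x y = m%:~R.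
Proof.
move=> Ddiv; rewrite /gcd_set [(\bigcup_(_ in D) _)%SET]big_mkcond /=.
rewrite partition_disjoint_bigcup => [|d d' dd']; last first.
  rewrite -setI_eq0; apply/eqP/setP => x; rewrite !inE.
  case: (d \in D); case: (d' \in D); rewrite !inE ?andbF //.
  by apply: contraNF dd' => /andP[/eqP xd /eqP xd']; rewrite -val_eqE /= -xd -xd'.
elim/big_ind: _ => [|_ _ [a ->] [b ->]|d _]; first by exists 0.
  by exists (a + b); rewrite rmorphD.
case: ifP => [/Ddiv/sum_chi_gcd_class//|_].
by exists 0; rewrite big1 // => x; rewrite inE.
Qed.

(** A Cayley graph has as eigenvalues the character sums over its connection set. As 1 is not in D,
    the elements 1 and -1 lie outside [gcd_set D], so the cycle and gcd contributions add up. *)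
Lemma spectrum_cycle_gcd (D : {set 'I_n}) :
  proper_divisors D -> (forall d, d \in D -> d != 1%N :> nat) ->
  exists g : 'Z_n -> int,
    has_spectrum chi (graph_union (cycle_graph n) (gcd_graph D))
      (fun y => w ^+ y + (w ^+ y)^-1 + (g y)%:~R).
Proof.
move=> Ddiv D1.
have [g gE] := choice (fun y => sum_chi_gcd_set (- y) Ddiv); exists g => x y.
have S1 : (1 : 'Z_n) \notin gcd_set D.
  apply/negP => /finset.bigcupP[d /D1 d1]; rewrite inE => /eqP dE.
  by move: d1; rewrite -dE (_ : (1 : 'Z_n) = 1%N :> nat) // gcd1n.
have SN1 : (-1 : 'Z_n) \notin gcd_set D.
  by apply: contra S1 => /gcd_setN; rewrite opprK.
(* Here n > 2 is essential: 1 + 1 must not wrap around to 0. *)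
have neq11 : (1 : 'Z_n) != -1.
  rewrite -subr_eq0 opprK; apply/eqP => /(congr1 (@nat_of_ord _)).
  by rewrite val_ZpD (_ : (1 : 'Z_n) = 1%N :> nat) // modn_small // (@ltn_exp2l 2 1).
have chiNr z : chi z (- y) = (chi z y)^-1 by rewrite chiC chiN chiC.
rewrite (reindex (fun z => x - z)) /=; last first.
  exact/onW_bij/(Bijective (subKr x) (subKr x)).
transitivity (\sum_z chi x y * (((z == 1)%:R + (z == -1)%:R + (z \in gcd_set D)%:R) *
    chi z (- y))).
  apply: eq_bigr => z _; rewrite chiD chiN chiNr /union_rel /= /cycle_rel /gcd_rel.
  rewrite subKr !inE; have [->|z1] := eqVneq z 1.
    by rewrite (negPf neq11) (negPf S1) /=; ring.
  have [->|zN1] := eqVneq z (-1); first by rewrite (negPf SN1) /=; ring.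
  by case: (z \in _) => /=; ring.
rewrite -mulr_sumr mulrC; congr (_ * _).
under eq_bigr do rewrite !mulrDl.
have delta a : \sum_z (z == a)%:R * chi z (- y) = chi a (- y).
  rewrite (bigD1 a) //= eqxx mul1r big1 ?addr0 // => z za.
  by rewrite (negPf za) mul0r.
rewrite !big_split /= !delta -gE chiN !chiNr invrK.
have -> : chi 1 y = w ^+ y by rewrite /chi (_ : (1 : 'Z_n) = 1%N :> nat) // mul1n.
rewrite [X in X + _ = _]addrC; congr (_ + _).
by rewrite [RHS]big_mkcond /=; apply: eq_bigr => z _; case: ifP; rewrite ?mul1r ?mul0r.
Qed.

(** The sign s is 1 on the family and -1 on complements; g collects every integer contribution. *)
Definition cos_spectrum (G : sgraph 'Z_n) := exists (s : int) (g : 'Z_n -> int),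
  s * s = 1 /\
  has_spectrum chi G (fun y => s%:~R * (w ^+ y + (w ^+ y)^-1) + (g y)%:~R).

Lemma calG_cos_spectrum (G : sgraph 'Z_n) : calG k G \/ calG_compl k G ->
  cos_spectrum G.
Proof.
have cs H : calG k H -> cos_spectrum H.
  case=> D [Ddiv D1 ->]; have [g gP] := spectrum_cycle_gcd Ddiv D1.
  by exists 1, g; split=> // x y; rewrite gP mul1r.
case=> [/cs //|[H /cs[s [g [ss sP]]] ->]].
exists (- s), (fun y => (#|{: 'Z_n}| * (y == 0))%:Z - 1 - g y).
split=> [|x y]; first by rewrite mulrNN.
rewrite (spectrum_compl _ sum_chi sP) => [|z]; last by rewrite chiC chi0.
by rewrite !rmorphB /= rmorphN -pmulrn; congr (_ * _); ring.
Qed.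

Definition chi2 (x y : 'Z_n * 'Z_n) : C := chi x.1 y.1 * chi x.2 y.2.

Lemma sum_chi2 y : \sum_x chi2 x y = (#|{: 'Z_n * 'Z_n}| * (y == 0))%:R.
Proof.
case: y => y1 y2; rewrite -(pair_bigA _ (fun x1 x2 => chi2 (x1, x2) (y1, y2))) /=.
under eq_bigr do rewrite -mulr_sumr sum_chi.
rewrite -mulr_suml sum_chi card_prod -natrM; congr (_%:R).
by rewrite xpair_eqE -mulnb mulnACA.
Qed.

Lemma chi2C x y : chi2 x y = chi2 y x.
Proof. by rewrite /chi2 chiC (chiC x.2). Qed.

Lemma chi2D x x' y : chi2 (x + x') y = chi2 x y * chi2 x' y.
Proof. by rewrite /chi2 !chiD /=; ring. Qed.

Lemma cart_cos_spectrum (G1 G2 : sgraph 'Z_n) :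
  cos_spectrum G1 -> cos_spectrum G2 ->
  forall G, G = cart_prod G1 G2 \/ G = graph_compl (cart_prod G1 G2) ->
  exists (s1 s2 : int) (g : 'Z_n * 'Z_n -> int), [/\ s1 * s1 = 1, s2 * s2 = 1 &
    has_spectrum chi2 G (fun y => s1%:~R * (w ^+ y.1 + (w ^+ y.1)^-1) +
      s2%:~R * (w ^+ y.2 + (w ^+ y.2)^-1) + (g y)%:~R)].
Proof.
move=> [s1 [g1 [ss1 sP1]]] [s2 [g2 [ss2 sP2]]] G.
have sP := spectrum_cart sP1 sP2.
case=> ->.
  exists s1, s2, (fun y => g1 y.1 + g2 y.2); split=> // x y.
  by rewrite [LHS]sP rmorphD; congr (_ * _); ring.
exists (- s1), (- s2),
  (fun y => (#|{: 'Z_n * 'Z_n}| * (y == 0))%:Z - 1 - (g1 y.1 + g2 y.2)).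
split=> [||x y]; rewrite ?mulrNN //.
rewrite (spectrum_compl _ sum_chi2 sP) => [|z]; last first.
  by rewrite /chi2 /= chiC (chiC z.2) !chi0 mulr1.
by rewrite !rmorphB /= rmorphD !rmorphN -pmulrn; congr (_ * _); ring.
Qed.

End Characters.

(** * Transfer times *)

Section RootOfUnity.
Variable R : realType.
Implicit Types x : R.

Lemma cis0 : cis 0 = 1 :> R[i].
Proof. by rewrite /cis cos0 sin0. Qed.

Lemma cisMn x m : cis (x *+ m) = cis x ^+ m.
Proof.
elim: m => [|m IH]; first by rewrite cis0.
by rewrite mulrS cisD IH exprS.
Qed.

Lemma cisN x : cis (- x) = (cis x)^-1.
Proof.
have cc : cis x * cis (- x) = 1 by rewrite -cisD subrr cis0.
have c0 : cis x != 0 by apply: contra_eq_neq cc => ->; rewrite mul0r eq_sym oner_eq0.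
by apply: (mulfI c0); rewrite cc divff.
Qed.

Lemma cis_pi_parity (z : int) (j : nat) : (2 %| z - j%:Z)%Z ->
  cis (pi * z%:~R) = (-1) ^+ j :> R[i].
Proof.
have cispi : cis pi = -1 :> R[i] by rewrite /cis cospi sinpi; simpc.
have even (w : nat) : cis (pi * (2 * w%:R)) = 1 :> R[i].
  by rewrite mulrA mulr_natr cisMn mulr_natr cisMn cispi sqrrN !expr1n.
case/dvdzP => w /eqP; rewrite subr_eq => /eqP ->.
rewrite intrD mulrDr cisD -[j%:Z%:~R]pmulrn (mulr_natr pi j) cisMn cispi.
rewrite intrM mulrC [w%:~R * _]mulrC.
have [m [->|->]] : exists m : nat, w = m%:Z \/ w = - m%:Z.
  by exists (absz w); lia.
  by rewrite -pmulrn even mulr1.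
rewrite rmorphN -pmulrn !mulrN.
by rewrite cisN even invr1 mulr1.
Qed.

Variable k : nat.
Hypothesis k_gt2 : (2 < k)%N.
Let x0 : R := pi *+ 2 / (2 ^ k)%:R.

Lemma mulrn_angle r : (r <= k)%N -> x0 *+ 2 ^ r = pi *+ 2 / (2 ^ (k - r))%:R.
Proof.
move=> rk; rewrite -[LHS]mulr_natr /x0 -{1}(subnK rk) expnD natrM invfM -!mulrA.
by rewrite mulVf ?mulr1 // pnatr_eq0 expn_eq0.
Qed.

(** An order properly dividing 2^k would divide 2^(k-1), but that power of [cis x0] is [cis pi] =
    -1. *)
Lemma cis_prim_root : (2 ^ k).-primitive_root (cis x0).
Proof.
have wn1 : cis x0 ^+ (2 ^ k) = 1.
  by rewrite -cisMn mulrn_angle // subnn divr1 /cis cos2pi sin2pi.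
have [m mprim] := prim_order_exists (expn_gt0 2 k) wn1.
case/(dvdn_pfactor _ _ (isT : prime 2)) => j; rewrite leq_eqVlt.
case/predU1P => [jk mE|jk mE]; first by rewrite -jk -mE.
have : cis x0 ^+ (2 ^ k.-1) = 1.
  apply/eqP; rewrite -(prim_order_dvd mprim) mE dvdn_exp2l //.
  by rewrite -ltnS prednK // ltnW // ltnW.
have kk : (k - k.-1 = 1)%N by move: k_gt2; clear; lia.
rewrite -cisMn mulrn_angle ?leq_pred // kk.
have -> : pi *+ 2 / (2 ^ 1)%:R = pi :> R.
  by rewrite expn1 -[pi *+ 2]mulr_natr mulfK ?pnatr_eq0.
move=> /eqP; rewrite /cis cospi sinpi eq_complex /=.
by case/andP=> /eqP; lra.
Qed.

Lemma cis_addV x : cis x + (cis x)^-1 = (2 * cos x)%:C.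
Proof.
by rewrite -cisN /cis cosN sinN; simpc; congr (_ +i* _); ring.
Qed.

Lemma cos_half_integer_approx (e : R) : 0 < e ->
  exists q : int, forall j, (j < 2 ^ k)%N -> exists z : int,
    `|2 * q%:~R * (2 * cos (x0 *+ j)) - z%:~R| < e /\ (2 %| z - j%:Z)%Z.
Proof.
(* Since 2^(k-2) x0 = pi / 2 has cosine 0, the number 2 cos x0 is a root of X^(2^r) + 2 N; k > 2
   makes the degree exceed 1. *)
move=> e0; set r := (k - 2)%N.
have r0 : (0 < r)%N by rewrite subn_gt0.
have [N [sN N0 cosN]] := cos_pow2_eisenstein r0.
pose d := (2 ^ r)%N.
have d_gt1 : (1 < d)%N by rewrite (@ltn_exp2l 2 0).
pose c i : int := if i == d then 1 else 2 * N`_i.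
have c_const : c 0%N = 2 * N`_0 by rewrite /c ltn_eqF // ltnW.
have c_even i : (i < d)%N -> (2 %| c i)%Z.
  by move=> id; rewrite /c ltn_eqF // dvdz_mulr.
have c_root : \sum_(i < d.+1) (c i)%:~R * (2 * cos x0) ^+ i = 0.
  rewrite big_ord_recr /= {2}/c eqxx mul1r.
  have := cosN R x0; rewrite mulrn_angle ?leq_subr // subKn ?(ltnW k_gt2) //.
  have -> : pi *+ 2 / (2 ^ 2)%:R = pi / 2 :> R.
    by rewrite natrX -[pi *+ 2]mulr_natr; field.
  rewrite cos_pihalf mulr0 addrC => zero; rewrite [RHS]zero; congr (_ + _).
  rewrite (@horner_coef_wide _ d) ?(leq_trans (size_poly _ _)) // mulr_sumr.
  apply: eq_bigr => i _; rewrite coef_map /c ltn_eqF //= intrM; ring.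
have c_lead : c d = 1 by rewrite /c eqxx.
have [q qP] :=
  integer_poly_approx d_gt1 c_lead c_const N0 c_even c_root dickson (2 ^ k) e0.
exists q => j /qP[z [zq z1]]; exists z; rewrite -dickson_cos; split=> //.
have := (dickson_coef01 j).2; move: z1; move: (dickson j)`_1; clear; lia.
Qed.

End RootOfUnity.

Lemma int_sqr_eq1 (s : int) : s * s = 1 -> s = 1 \/ s = -1.
Proof.
by move/eqP; rewrite -expr2 sqrf_eq1 => /orP[] /eqP ->; [left|right].
Qed.

Lemma parity_combination (s1 s2 z1 z2 a : int) (j1 j2 : nat) :
  s1 * s1 = 1 -> s2 * s2 = 1 -> (2 %| z1 - j1%:Z)%Z -> (2 %| z2 - j2%:Z)%Z ->
  (2 %| - (s1 * z1 + s2 * z2 + 2 * a) - (j1 + j2)%N%:Z)%Z.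
Proof.
by move=> /int_sqr_eq1[->|->] /int_sqr_eq1[->|->]; lia.
Qed.

(** [cis (pi * u m)] splits into [cis (pi * z m)], constantly (-1)^j, and a factor whose angle tends
    to 0. *)
Lemma cvg_cis_parity (R : realType) (u : nat -> R) (z : nat -> int) (C : R) (j : nat) :
  (forall m, (2 %| z m - j%:Z)%Z) ->
  (forall m, `|u m - (z m)%:~R| <= C * m.+1%:R^-1) ->
  (fun m => cis (pi * u m)) @ \oo --> ((-1) ^+ j : R[i]).
Proof.
move=> zj uz.
have d0 : (fun m => pi * (u m - (z m)%:~R)) @ \oo --> (0 : R).
  rewrite -[X in _ --> X](mulr0 pi); apply: cvgM; first exact: cvg_cst.
  apply/cvgr0Pnorm_le => e e0.
  have : (fun m : nat => C * m.+1%:R^-1) @ \oo --> (0 : R).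
    rewrite -[X in _ --> X](mulr0 C).
    by apply: cvgM; [exact: cvg_cst|exact: cvg_harmonic].
  move/cvgr0Pnorm_le/(_ e e0); apply: filterS => m; apply: le_trans.
  exact: le_trans (uz m) (ler_norm _).
have -> : (fun m => cis (pi * u m)) =
    (fun m => (-1) ^+ j * cis (pi * (u m - (z m)%:~R)) : R[i]).
  apply/funext => m; rewrite -(cis_pi_parity R (zj m)) -cisD; congr cis; ring.
rewrite -[X in _ --> X]mulr1; apply: cvgM; first exact: cvg_cst.
rewrite -cis0; apply: cvg_complex.
  by apply: continuous_cvg d0; exact: continuous_cos.
by apply: continuous_cvg d0; exact: continuous_sin.
Qed.

(** * State transfer from (0, 0) to (n/2, n/2) *)

Section PrettyGood.
Variables (R : realType) (k : nat).
Hypothesis k_gt2 : (2 < k)%N.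
Let n := (2 ^ k)%N.
Let x0 : R := pi *+ 2 / (2 ^ k)%:R.
Let w := cis x0.

Lemma pgst_cos_spectrum (G : sgraph ('Z_n * 'Z_n)%type) (s1 s2 : int)
    (g : 'Z_n * 'Z_n -> int) :
  s1 * s1 = 1 -> s2 * s2 = 1 ->
  has_spectrum (chi2 w) G (fun y => s1%:~R * (w ^+ y.1 + (w ^+ y.1)^-1) +
      s2%:~R * (w ^+ y.2 + (w ^+ y.2)^-1) + (g y)%:~R) ->
  admits_pgst R G.
Proof.
move=> ss1 ss2 spec; have w_prim := cis_prim_root R k_gt2.
have k_gt1 := ltnW k_gt2.
pose th (y : 'Z_n) : R := 2 * cos (x0 *+ y).
pose lam y : R := s1%:~R * th y.1 + s2%:~R * th y.2 + (g y)%:~R.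
have specR x y : \sum_v (G x v)%:R * chi2 w v y = (lam y)%:C * chi2 w x y.
  rewrite spec -!cisMn !cis_addV; congr (_ * _).
  by rewrite !rmorphD !rmorphM /= !rmorph_int.
have [q qP] : exists q : nat -> int, forall (m : nat) (j : 'Z_n), exists z : int,
    `|2 * (q m)%:~R * th j - z%:~R| < m.+1%:R^-1 /\ (2 %| z - (j : nat)%:Z)%Z.
  suff /choice[q qP] : forall m : nat, exists q : int, forall j : 'Z_n,
      exists z : int, `|2 * q%:~R * th j - z%:~R| < m.+1%:R^-1 /\
      (2 %| z - (j : nat)%:Z)%Z by exists q.
  move=> m; have m0 : 0 < m.+1%:R^-1 :> R by rewrite invr_gt0.
  have [q qP] := cos_half_integer_approx k_gt2 m0; exists q => j; apply: qP.
  by rewrite -[X in (_ < X)%N](Zp_cast (ltn_trans k_gt1 (ltn_expl k (isT : 1 < 2)%N))).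
pose h : 'Z_n := inZp (2 ^ k.-1).
have n_gt1 : (1 < n)%N := ltn_trans k_gt1 (ltn_expl k (isT : 1 < 2)%N).
have kE : k = k.-1.+1 by rewrite prednK // ltnW // ltnW.
have hE : h = (2 ^ k.-1)%N :> nat.
  by rewrite /h /= Zp_cast // modn_small // /n {2}kE ltn_exp2l.
(* The element h is n/2 and w^(n/2) = [cis pi] = -1. *)
have chih y : chi w h y = (-1) ^+ y.
  rewrite /chi hE exprM -cisMn mulrn_angle ?leq_pred //.
  have -> : pi *+ 2 / (2 ^ (k - k.-1))%:R = pi :> R.
    rewrite (_ : (k - k.-1)%N = 1%N) ?expn1; last by move: k_gt2; clear; lia.
    by rewrite -[pi *+ 2]mulr_natr mulfK ?pnatr_eq0.
  by rewrite /cis cospi sinpi; simpc.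
exists (0, 0), (h, h).
have N0 : (#|{: 'Z_n * 'Z_n}|)%:R != 0 :> R[i].
  by rewrite pnatr_eq0 -lt0n; apply/card_gt0P; exists (0, 0).
pose par (y : 'Z_n * 'Z_n) : R[i] := (-1) ^+ (y.1 + y.2).
(* The dual basis consists of the inverse characters divided by the group order, and [par] is the
   ratio of its values at (h, h) and (0, 0). *)
apply: (@pgst_eigenbasis _ _ _ _ _ (chi2 w)
  (fun x y => chi2 w (- x) y / (#|{: 'Z_n * 'Z_n}|)%:R) lam
  (fun m => pi *+ 2 * (q m)%:~R) par).
- move=> /(congr1 (fun v : 'Z_n * 'Z_n => v.1 : nat)) /eqP.
  by rewrite hE eq_sym expn_eq0.
- exact: specR.
- move=> x x'; under eq_bigr do rewrite mulrA -chi2D // chi2C //.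
  rewrite -mulr_suml sum_chi2 // subr_eq0; case: eqVneq => _.
    by rewrite muln1 divff.
  by rewrite muln0 mul0r.
- move=> y; have /choice[z1 z1P] := fun m => qP m y.1.
  have /choice[z2 z2P] := fun m => qP m y.2.
  have -> : (fun m => cis (- (pi *+ 2 * (q m)%:~R * lam y))) =
      (fun m => cis (pi * - (2 * (q m)%:~R * lam y))).
    by apply/funext => m; congr cis; rewrite -mulr_natr; ring.
  (* The integer near - 2 q lam(y); modulo 2 it is y.1 + y.2, whatever the signs and the integer
     part [g y]. *)
  pose z m := - (s1 * z1 m + s2 * z2 m + 2 * (q m * g y)).
  (* The constant 2 counts the two cosine errors, each below 1/(m+1). *)
  apply: (@cvg_cis_parity _ _ z 2) => m.
    by apply: parity_combination => //; [have [] := z1P m|have [] := z2P m].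
  have norm1 (s : int) : s * s = 1 -> `|s%:~R| = 1 :> R.
    by move=> ss; rewrite -intr_norm; case: (int_sqr_eq1 ss) => ->.
  have [e1 _] := z1P m; have [e2 _] := z2P m.
  have -> : - (2 * (q m)%:~R * lam y) - (z m)%:~R =
      s1%:~R * ((z1 m)%:~R - 2 * (q m)%:~R * th y.1) +
      s2%:~R * ((z2 m)%:~R - 2 * (q m)%:~R * th y.2).
    by rewrite /lam /z rmorphN !rmorphD !rmorphM /=; ring.
  apply: le_trans (ler_normD _ _) _; rewrite !normrM !norm1 // !mul1r.
  rewrite [leRHS](_ : _ = m.+1%:R^-1 + m.+1%:R^-1); last by ring.
  by rewrite lerD // distrC ltW.
- move=> y; rewrite /chi2 /= !oppr0 !chi0 mulrA mulr1 mulr1; congr (_ / _).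
  rewrite !chiN // !chih /par exprD.
  by rewrite !invr_sign.
Qed.
End PrettyGood.

Theorem corollary2p4 (R : realType) (k : nat) (hk : (3 <= k)%N)
    (G1 G2 : sgraph 'Z_(2 ^ k))
    (hG1 : calG k G1 \/ calG_compl k G1)
    (hG2 : calG k G2 \/ calG_compl k G2) :
  admits_pgst R (cart_prod G1 G2) /\
  admits_pgst R (graph_compl (cart_prod G1 G2)).
Proof.
have w_prim := cis_prim_root R hk.
have c1 := calG_cos_spectrum (ltnW hk) w_prim hG1.
have c2 := calG_cos_spectrum (ltnW hk) w_prim hG2.
have pgst G : G = cart_prod G1 G2 \/ G = graph_compl (cart_prod G1 G2) ->
    admits_pgst R G.
  move=> /(cart_cos_spectrum (ltnW hk) w_prim c1 c2) [s1 [s2 [g [ss1 ss2 spec]]]].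
  exact: pgst_cos_spectrum ss1 ss2 spec.
by split; apply: pgst; [left|right].
Qed.
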